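(* Consider the event-triggered diffusion Kalman filter for the linear time-varying system $x_{i+1}=F_ix_i+G_in_i$, $y_{kj,i}=H_{j,i}x_i+v_{j,i}$ (the algorithm, notation and standing assumptions being those given in the context). Let $i\ge 0$ and $M\ge 0$ be such that $i$ and $i+M+1$ are consecutive triggering times, i.e. the triggering event $\operatorname{tr}(WP_{L,s|s-1}W^T)>\pi_{\max}$ holds for $s=i$ and $s=i+M+1$ and fails for $s=i+1,\dots,i+M$ (so that $M$ propagation updates are executed in between). Then the covariance $\mathcal{P}_{\tilde{\mathcal{X}}|s}=\mathbb{E}\big(\tilde{\mathcal{X}}_{s|s}\tilde{\mathcal{X}}_{s|s}^T\big)$ of the augmented state error and the diffusion error covariances $P_{k,s|s}$, $P_{k,s|s-1}$ (collected in the block-diagonal matrices $\mathcal{P}_{s|s}$, $\mathcal{P}_{s|s-1}$) are related by $$\mathcal{P}_{\tilde{\mathcal{X}}|i+M+1}=A_i\,\mathcal{P}_{\tilde{\mathcal{X}}|i}\,A_i^T+B_i\big(\mathbf{1}\mathbf{1}^T\otimes Q_{i+M}\big)B_i^T+\sum_{l=1}^{M}D_{i,l}\big(\mathbf{1}\mathbf{1}^T\otimes Q_{i+l-1}\big)D_{i,l}^T+E_i\,\mathcal{R}_{i+M+1}\,E_i^T,$$ where $$Z_i:=\mathcal{C}^T\mathcal{P}_{i+M+1|i+M+1}\mathcal{P}_{i+M+1|i+M}^{-1},\qquad A_i:=Z_i\Big(I_N\otimes\prod_{j=0}^{M}F_{i+M-j}\Big),\qquad B_i:=Z_i\big(I_N\otimes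 G_{i+M}\big),$$ $$D_{i,l}:=Z_i\Big(I_N\otimes\prod_{j=0}^{M-l}F_{i+M-j}\Big)\big(I_N\otimes G_{i+l-1}\big),\qquad E_i:=\mathcal{C}^T\mathcal{P}_{i+M+1|i+M+1}\mathcal{A}^T\mathcal{H}_{i+M+1}^T\mathcal{R}_{i+M+1}^{-1},$$ and the matrix products are ordered from left to right with increasing $j$, i.e. $\prod_{j=0}^{r}F_{i+M-j}=F_{i+M}F_{i+M-1}\cdots F_{i+M-r}$.
   Context: System. There are $N$ nodes, indexed by $k\in\{1,\dots,N\}$; node $k$ has a neighbor set $\mathcal{N}_k\subseteq\{1,\dots,N\}$. The state $x_i\in\mathbb{R}^m$ evolves for $i\ge 0$ by $x_{i+1}=F_ix_i+G_in_i$ with deterministic matrices $F_i,G_i$. At time $i$ the measurement available to node $k$ from its neighbor $j\in\mathcal{N}_k$ is $y_{kj,i}=H_{j,i}x_i+v_{j,i}\in\mathbb{R}^{d}$ with $H_{j,i}$ deterministic. The random vectors $x_0$, $n_i$ ($i\ge0$), $v_{k,i}$ ($1\le k\le N$, $i\ge 0$) are mutually independent; $\mathbb{E}x_0=0$ and $x_0$ has covariance $\Pi_0$ (positive definite); $n_i$ and $v_{k,i}$ are zero-mean Gaussian with $\mathbb{E}[n_in_i^T]=Q_i$ (positive semidefinite) and $\mathbb{E}[v_{k,i}v_{k,i}^T]=R_i$ (positive definite). Diffusion weights. The weights $c_{j,k}\ge 0$ satisfy $c_{j,k}=0$ for $j\notin\mathcal{N}_k$ and $\sum_{j\in\mathcal{N}_k}c_{j,k}=1$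 for every $k$ (convex combination). Event-triggered diffusion Kalman filter. Fix a leader node $L\in\{1,\dots,N\}$, a (deterministic) weighting matrix $W$ and a threshold $\pi_{\max}\in\mathbb{R}$. Initialize $\hat{x}_{k,0|-1}=0$ and $P_{k,0|-1}=\Pi_0$ for all $k$. At each time $i=0,1,2,\dots$ every node $k$ does the following. (a) If $\operatorname{tr}(WP_{L,i|i-1}W^T)>\pi_{\max}$ (triggering event), perform the measurement update $$P_{k,i|i}^{-1}=P_{k,i|i-1}^{-1}+\sum_{j\in\mathcal{N}_k}H_{j,i}^TR_i^{-1}H_{j,i},$$ $$\Psi_{k,i}=\hat{x}_{k,i|i-1}+P_{k,i|i}\sum_{j\in\mathcal{N}_k}H_{j,i}^TR_i^{-1}\big[y_{kj,i}-H_{j,i}\hat{x}_{k,i|i-1}\big],$$ followed by the diffusion update $\hat{x}_{k,i|i}=\sum_{j\in\mathcal{N}_k}c_{j,k}\Psi_{j,i}$. (b) Otherwise, perform the propagation update $\hat{x}_{k,i|i}=\hat{x}_{k,i|i-1}$, $P_{k,i|i}=P_{k,i|i-1}$. (c) In all cases, perform the time update $\hat{x}_{k,i+1|i}=F_i\hat{x}_{k,i|i}$, $P_{k,i+1|i}=F_iP_{k,i|i}F_i^T+G_iQ_iG_i^T$. The matrices $P_{k,i|i-1}$ are assumed invertible, so that all the steps are well defined. The matrix $P_{k,i|i}$ is called the diffusion error covariance of node $k$ (it is in general not the covariance of the estimation error). Augmented notation. $\tilde{x}_{k,i|i}:=x_i-\hat{x}_{k,i|i}$, and $\tilde{\mathcal{X}}_{i|i}\in\mathbb{R}^{Nm}$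 is the column vector obtained by stacking $\tilde{x}_{1,i|i},\dots,\tilde{x}_{N,i|i}$. The matrices $\mathcal{H}_i:=\operatorname{diag}(H_{1,i},\dots,H_{N,i})$, $\mathcal{P}_{i|i}:=\operatorname{diag}(P_{1,i|i},\dots,P_{N,i|i})$, $\mathcal{P}_{i|i-1}:=\operatorname{diag}(P_{1,i|i-1},\dots,P_{N,i|i-1})$ and $\mathcal{R}_i:=\operatorname{diag}(R_i,\dots,R_i)=I_N\otimes R_i$ ($N$ blocks; it is the covariance matrix of the stacked measurement noise of $v_{1,i},\dots,v_{N,i}$) are block diagonal. $C$ is the $N\times N$ matrix with entry $c_{l,k}$ in row $l$, column $k$; $A$ is the $N\times N$ adjacency matrix with entry $a_{l,k}=1$ if $l\in\mathcal{N}_k$ and $a_{l,k}=0$ otherwise; $\mathcal{C}:=C\otimes I_m$, $\mathcal{A}:=A\otimes I_m$ (the adjacency matrix $A$ is not to be confused with the matrices $A_i$ of the claim). $\otimes$ is the Kronecker product, $\mathbf{1}\in\mathbb{R}^N$ is the all-ones column vector, $I_r$ is the $r\times r$ identity matrix. *)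

(* Defs.v *)
From HB Require Import structures.
From mathcomp Require Import all_boot all_order all_algebra.
From mathcomp Require Import mxtens.
From mathcomp Require Import all_classical all_reals all_analysis.

Set Implicit Arguments.
Unset Strict Implicit.
Unset Printing Implicit Defensive.

Import Order.TTheory GRing.Theory Num.Theory.
Import numFieldNormedType.Exports.

Local Open Scope classical_set_scope.
Local Open Scope ring_scope.

Definition psdmx {R : realType} {n : nat} (S : 'M[R]_n) : Prop :=
  S^T = S /\ forall u : 'cV[R]_n, 0 <= (u^T *m S *m u) 0 0.

Definition pdmx {R : realType} {n : nat} (S : 'M[R]_n) : Prop :=
  S^T = S /\ forall u : 'cV[R]_n, u != 0 -> 0 < (u^T *m S *m u) 0 0.

(* Indexing of stacked vectors and block matrices follows the Kronecker
   product [*t]: component [a] of block [k] has index [mxtens_index (k, a)]. *)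
Definition stackv {R : realType} {N m : nat} (x : 'I_N -> 'cV[R]_m) :
    'cV[R]_(N * m) :=
  \col_r x (mxtens_unindex r).1 (mxtens_unindex r).2 0.

Definition blockdiag {R : realType} {N m n : nat} (B : 'I_N -> 'M[R]_(m, n)) :
    'M[R]_(N * m, N * n) :=
  \matrix_(r, s)
    if (mxtens_unindex r).1 == (mxtens_unindex s).1
    then B (mxtens_unindex r).1 (mxtens_unindex r).2 (mxtens_unindex s).2
    else 0.

Section Probability.
Context {disp : measure_display} {T : measurableType disp} {R : realType}.
Implicit Type P : probability T R.

Definition random_vector {n : nat} (X : T -> 'cV[R]_n) : Prop :=
  forall a, measurable_fun [set: T] (fun w => X w a 0).

(* The sigma-algebra on [T] generated by [X], i.e. by its coordinates. *)
Definition sigma_vector {n : nat} (X : T -> 'cV[R]_n) : set_system T :=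
  g_sigma_preimage (fun a w => X w a 0).

Definition mutually_independent P (I : eqType) (G : I -> set_system T) : Prop :=
  forall (J : seq I) (A : I -> set T), uniq J ->
    (forall a, a \in J -> G a (A a)) ->
    P (\bigcap_(a in [set` J]) A a) = (\prod_(a <- J) P (A a))%E.

(* The case [s == 0] is the degenerate (Dirac) Gaussian law, which
   [normal_prob] does not provide: [normal_prob mu 0] is uniform on [0, 1]. *)
Definition gaussian_rv P (Z : T -> R) : Prop :=
  exists mu s : R, forall B : set R, measurable B ->
    P (Z @^-1` B) = if s == 0 then \d_mu B else normal_prob mu s B.

Definition gaussian_vector P {n : nat} (X : T -> 'cV[R]_n) : Prop :=
  forall u : 'cV[R]_n, gaussian_rv P (fun w => (u^T *m X w) 0 0).

(* Entrywise expectation, in the extended reals.  An equality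
   [expectation_mx P M = map_mx EFin S] with measurable entries implies that
   all the entries are integrable. *)
Definition expectation_mx P {m n : nat} (M : T -> 'M[R]_(m, n)) :
    'M[\bar R]_(m, n) :=
  \matrix_(a, b) 'E_P[fun w => M w a b]%E.

Definition covariance_mx P {n : nat} (X : T -> 'cV[R]_n) : 'M[\bar R]_n :=
  \matrix_(a, b) covariance P (fun w => X w a 0) (fun w => X w b 0).

End Probability.

(* Deterministic data of the filter for [N] nodes, states in R^m, process noise
   in R^p, measurements in R^d and a [q] x [m] weighting matrix. *)
Record dkf (R : realType) (N m p d q : nat) := Dkf {
  dkf_F : nat -> 'M[R]_m;
  dkf_G : nat -> 'M[R]_(m, p);
  dkf_H : 'I_N -> nat -> 'M[R]_(d, m);
  dkf_Q : nat -> 'M[R]_p;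
  dkf_R : nat -> 'M[R]_d;
  dkf_Pi0 : 'M[R]_m;
  dkf_nbr : 'I_N -> {set 'I_N};
  dkf_C : 'M[R]_N; (* [dkf_C j k] is the weight node k gives to neighbor j *)
  dkf_L : 'I_N;
  dkf_W : 'M[R]_(q, m);
  dkf_pimax : R
}.

Section Filter.
Context {R : realType} {N m p d q : nat} (S : dkf R N m p d q).

Local Notation F := (dkf_F S).
Local Notation G := (dkf_G S).
Local Notation H := (dkf_H S).
Local Notation Q := (dkf_Q S).
Local Notation Rv := (dkf_R S).
Local Notation nbr := (dkf_nbr S).
Local Notation C := (dkf_C S).
Local Notation W := (dkf_W S).

Definition adjacency : 'M[R]_N := \matrix_(l, k) (l \in nbr k)%:R.

Definition triggered (P : 'I_N -> 'M[R]_m) : bool :=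
  dkf_pimax S < \tr (W *m P (dkf_L S) *m W^T).

Definition cov_update (i : nat) (P : 'I_N -> 'M[R]_m) (k : 'I_N) : 'M[R]_m :=
  if triggered P then
    invmx (invmx (P k) +
           \sum_(j in nbr k) (H j i)^T *m invmx (Rv i) *m H j i)
  else P k.

(* [Ppred i k] is P_{k,i|i-1} and [Pfilt i k] is P_{k,i|i}. *)
Fixpoint Ppred (i : nat) : 'I_N -> 'M[R]_m :=
  if i is i'.+1 then
    fun k => F i' *m cov_update i' (Ppred i') k *m (F i')^T
             + G i' *m Q i' *m (G i')^T
  else fun=> dkf_Pi0 S.

Definition Pfilt (i : nat) : 'I_N -> 'M[R]_m := cov_update i (Ppred i).

Definition trigger (i : nat) : bool := triggered (Ppred i).

(* [y j] is the measurement coming from node [j]; it is the same for all the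
   nodes that receive it. *)
Definition Psi (i : nat) (xp : 'I_N -> 'cV[R]_m) (y : 'I_N -> 'cV[R]_d)
    (k : 'I_N) : 'cV[R]_m :=
  xp k + Pfilt i k *m
    \sum_(j in nbr k) (H j i)^T *m invmx (Rv i) *m (y j - H j i *m xp k).

Definition est_update (i : nat) (xp : 'I_N -> 'cV[R]_m) (y : 'I_N -> 'cV[R]_d)
    (k : 'I_N) : 'cV[R]_m :=
  if trigger i then \sum_(j in nbr k) C j k *: Psi i xp y j else xp k.

Context {T : Type} (x0 : T -> 'cV[R]_m) (n : nat -> T -> 'cV[R]_p)
  (v : 'I_N -> nat -> T -> 'cV[R]_d).

Fixpoint state (i : nat) (w : T) : 'cV[R]_m :=
  if i is i'.+1 then F i' *m state i' w + G i' *m n i' w else x0 w.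

Definition meas (i : nat) (w : T) (j : 'I_N) : 'cV[R]_d :=
  H j i *m state i w + v j i w.

(* [xpred i w k] is the estimate of node k at i|i-1, [xfilt i w k] at i|i. *)
Fixpoint xpred (i : nat) (w : T) : 'I_N -> 'cV[R]_m :=
  if i is i'.+1 then
    fun k => F i' *m est_update i' (xpred i' w) (meas i' w) k
  else fun=> 0.

Definition xfilt (i : nat) (w : T) : 'I_N -> 'cV[R]_m :=
  est_update i (xpred i w) (meas i w).

Definition aug_error (i : nat) (w : T) : 'cV[R]_(N * m) :=
  stackv (fun k => state i w - xfilt i w k).

End Filter.

Section Randomness.
Context {disp : measure_display} {T : measurableType disp} {R : realType}.
Context (P : probability T R) {N m p d q : nat} (S : dkf R N m p d q).
Context (x0 : T -> 'cV[R]_m) (n : nat -> T -> 'cV[R]_p)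
  (v : 'I_N -> nat -> T -> 'cV[R]_d).

(* The family of all the sources of randomness:
   x_0, then the n_i, then the v_{k,i}. *)
Definition source_sigma (a : unit + nat + 'I_N * nat) : set_system T :=
  match a with
  | inl (inl _) => sigma_vector x0
  | inl (inr i) => sigma_vector (n i)
  | inr (k, i) => sigma_vector (v k i)
  end.

Definition error_second_moment (s : nat) : 'M[\bar R]_(N * m) :=
  expectation_mx P
    (fun w => aug_error S x0 n v s w *m (aug_error S x0 n v s w)^T).

Definition error_cov (s : nat) : 'M[R]_(N * m) :=
  map_mx fine (error_second_moment s).

End Randomness.

(* Main.v *)
Require Import Defs.
From HB Require Import structures.
From mathcomp Require Import all_boot all_order all_algebra.
From mathcomp Require Import mxtens.
From mathcomp Require Import all_classical all_reals all_analysis.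
From mathcomp Require Import measurable_realfun.
From mathcomp Require Import ring.

(* All sources of randomness enter the errors linearly, so second moments and
   uncorrelatedness are enough.  Let e_s be the stacked prediction error
   (x_s - xhat_{k,s|s-1})_k, n_s^N the stack of N copies of n_s, and v_s the
   stack of the v_{k,s}.  Then
     e_{s+1} = (I (x) F_s) Xtilde_{s|s} + (I (x) G_s) n_s^N,
     Xtilde_{s|s} = Z e_s - E v_s  at a triggering time,
     Xtilde_{s|s} = e_s            otherwise,
   where Z and E come from P_{k|k} P_{k|k-1}^-1 = I - P_{k|k} sum H^T R^-1 H and
   from the weights summing to 1.  In each step the new noise is uncorrelated
   with the current error, because that error is a linear combination of
   independent centred sources other than the new noise, so covariances obey
   the matching Lyapunov recursion, which is unrolled over the M propagation
   steps.  Every P_{k,s|s-1} is positive definite, being positive semidefinite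
   and invertible; this is what makes the matrix inverted in the measurement
   update invertible. *)

Set Implicit Arguments.
Unset Strict Implicit.
Unset Printing Implicit Defensive.

Import Order.TTheory GRing.Theory Num.Theory.
Import numFieldNormedType.Exports.

Local Open Scope classical_set_scope.
Local Open Scope ring_scope.

(** * Square-integrable random vectors and their cross second moments *)

Section SecondMoments.
Context {disp : measure_display} {T : measurableType disp} {R : realType}.
Variable P : probability T R.

(** The squared L2 norm of [X] is exactly this expectation. Through it the extended-real moment
    hypotheses yield integrability. *)
Lemma Lfun2_expectation_sqr (X : T -> R) :
  measurable_fun [set: T] X -> 'E_P[(fun w => X w * X w)%R]%E \is a fin_num ->
  X \in Lfun P 2%:E.
Proof.
move=> mX; rewrite unlock => EX.
rewrite inE; apply/andP; split; rewrite inE//=.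
rewrite /finite_norm unlock poweR_lty//.
under eq_integral => x _.
  rewrite (_ : `|(EFin \o X) x| `^ 2 = (X x * X x)%:E)%E; last first.
    by rewrite /= powR_mulrn// -normrX ger0_norm ?sqr_ge0// expr2.
  over.
by rewrite ltey_eq EX.
Qed.

(** The law of [(X, Y)] agrees with the product of the marginal laws on rectangles, hence
    everywhere, and Fubini splits the integral of [x * y]. *)
Lemma expectationM_indep (X Y : T -> R) :
  measurable_fun [set: T] X -> measurable_fun [set: T] Y ->
  (forall A B, measurable A -> measurable B ->
    P (X @^-1` A `&` Y @^-1` B) = P (X @^-1` A) * P (Y @^-1` B))%E ->
  X \in Lfun P 1 -> Y \in Lfun P 1 -> X \* Y \in Lfun P 1 ->
  ('E_P[(X \* Y)%R] = 'E_P[X] * 'E_P[Y])%E.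
Proof.
move=> mX mY indep X1 Y1 XY1.
pose X' : {mfun T >-> R} := HB.pack X (isMeasurableFun.Build _ _ _ _ X mX).
pose Y' : {mfun T >-> R} := HB.pack Y (isMeasurableFun.Build _ _ _ _ Y mY).
have mZ : measurable_fun [set: T] (fun w => (X w, Y w)).
  exact: measurable_fun_pair.
pose Z : {mfun T >-> (R * R)%type} :=
  HB.pack (fun w => (X w, Y w)) (isMeasurableFun.Build _ _ _ _ _ mZ).
pose PX := distribution P X'; pose PY := distribution P Y'.
pose PZ := distribution P Z.
have PZE A : measurable A -> (PX \x PY)%E A = PZ A.
  move=> mA; exact: product_measure_unique.
pose f (z : R * R) := (z.1 * z.2)%:E.
have mf : measurable_fun [set: (measurableTypeR R * measurableTypeR R)%type] f.
  apply/measurable_EFinP; exact: measurable_funM.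
have E1 : (\int[P]_w (X w * Y w)%:E = \int[PZ]_z f z)%E.
  rewrite integral_distribution//; exact/Lfun1_integrable.
(* Fubini needs integrability under the product law; since that law is the joint one, integrability
   of [X \* Y] provides it. *)
have intf : (PX \x PY)%E.-integrable setT f.
  apply/integrableP; split => //.
  rewrite (eq_measure_integral PZ); last by move=> A mA _; exact: PZE.
  rewrite ge0_integral_distribution//; last exact: measurableT_comp.
  by have /Lfun1_integrable/integrableP[_] := XY1.
have E2 : (\int[PZ]_z f z = \int[PX]_x \int[PY]_y f (x, y))%E.
  rewrite integral12_prod_meas1//; apply: eq_measure_integral => A mA _.
  exact/esym/PZE.
have mid (D : set R) : measurable_fun D (EFin : R -> \bar R).
  exact/measurable_EFinP.
have iY : PY.-integrable setT (EFin : R -> \bar R).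
  apply/integrableP; split => //.
  rewrite ge0_integral_distribution//; last exact: measurableT_comp.
  by have /Lfun1_integrable/integrableP[_] := Y1.
have iX : PX.-integrable setT (EFin : R -> \bar R).
  apply/integrableP; split => //.
  rewrite ge0_integral_distribution//; last exact: measurableT_comp.
  by have /Lfun1_integrable/integrableP[_] := X1.
rewrite {1}unlock [LHS]E1 E2.
under eq_integral => x _.
  rewrite /f /=; under eq_integral do rewrite EFinM.
  rewrite integralZl//=.
  have -> : (\int[PY]_y y%:E = (fine (expectation P Y))%:E)%E.
    rewrite fineK ?expectation_fin_num// unlock integral_distribution//.
    exact/Lfun1_integrable.
  over.
rewrite /= integralZr//= integral_distribution//; last exact/Lfun1_integrable.
by rewrite fineK ?expectation_fin_num//; congr (_ * _)%E; rewrite unlock.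
Qed.

Lemma Lfun2D (X Y : T -> R) : X \in Lfun P 2%:E -> Y \in Lfun P 2%:E ->
  (fun w => X w + Y w) \in Lfun P 2%:E.
Proof.
move=> X2 Y2; have := (Lfun_submod_closed P (lee1n 2)).2 1 X Y X2 Y2.
by rewrite scale1r.
Qed.

Lemma Lfun2_suml (I : finType) (c : I -> R) (X : I -> T -> R) :
  (forall k, X k \in Lfun P 2%:E) ->
  (fun w => \sum_k c k * X k w) \in Lfun P 2%:E.
Proof.
move=> X2; have [L0 Llin] := Lfun_submod_closed P (lee1n 2).
have -> : (fun w => \sum_k c k * X k w) = \sum_k c k *: X k.
  by apply/funext => w; rewrite fct_sumE.
by elim/big_rec: _ => // k f _ f2; apply: Llin.
Qed.

Lemma expectation_suml (I : finType) (c : I -> R) (X : I -> T -> R) :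
  (forall k, X k \in Lfun P 1) ->
  fine (expectation P (fun w => \sum_k c k * X k w))
    = \sum_k c k * fine (expectation P (X k)).
Proof.
move=> X1; have [L0 Llin] := Lfun_submod_closed P (lexx 1%E).
have -> : (fun w => \sum_k c k * X k w) = \sum_k c k *: X k.
  by apply/funext => w; rewrite fct_sumE.
(* Integrability is carried along with the value, because additivity of the expectation requires it
   of both summands. *)
suff [_ ->] : \sum_k c k *: X k \in Lfun P 1 /\
  expectation P (\sum_k c k *: X k)
    = (\sum_k c k * fine (expectation P (X k)))%:E by [].
elim/big_ind2: _ => [|x f y g [f1 fE] [g1 gE]|k _].
- by split => //; rewrite [X in expectation _ X]/= (expectation_cst P 0).
- by split; [rewrite -[f]scale1r; exact: Llin
            |rewrite [LHS]expectationD// fE gE].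
- split; first by rewrite -[_ *: _]addr0; exact: Llin.
  have -> : c k *: X k = c k \o* X k by apply/funext => w; rewrite /= mulrC.
  by rewrite expectationZl// EFinM fineK// expectation_fin_num.
Qed.

Definition sqint {a} (X : T -> 'cV[R]_a) : Prop :=
  forall i, (fun w => X w i 0) \in Lfun P 2%:E.

(** This is E[X Y^T] as a real matrix; [fine] loses nothing when both vectors satisfy [sqint], the
    products then being integrable. *)
Definition xmoment {a b} (X : T -> 'cV[R]_a) (Y : T -> 'cV[R]_b) :
    'M[R]_(a, b) :=
  \matrix_(i, j) fine (expectation P (fun w => X w i 0 * Y w j 0)).

Lemma sqint_Lfun1 {a b} (X : T -> 'cV[R]_a) (Y : T -> 'cV[R]_b) i j :
  sqint X -> sqint Y -> (fun w => X w i 0 * Y w j 0) \in Lfun P 1.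
Proof. by move=> X2 Y2; apply: Lfun2_mul_Lfun1. Qed.

Lemma sqintD {a} (X Y : T -> 'cV[R]_a) :
  sqint X -> sqint Y -> sqint (fun w => X w + Y w).
Proof.
move=> X2 Y2 i; under eq_fun do rewrite mxE; exact: Lfun2D.
Qed.

Lemma sqintM {a b} (A : 'M[R]_(b, a)) (X : T -> 'cV[R]_a) :
  sqint X -> sqint (fun w => A *m X w).
Proof.
move=> X2 i; under eq_fun do rewrite mxE; exact: Lfun2_suml.
Qed.

Lemma trmx_xmoment {a b} (X : T -> 'cV[R]_a) (Y : T -> 'cV[R]_b) :
  (xmoment X Y)^T = xmoment Y X.
Proof.
by apply/matrixP => i j; rewrite !mxE; under eq_fun do rewrite mulrC.
Qed.

Lemma xmomentDl {a b} (X X' : T -> 'cV[R]_a) (Y : T -> 'cV[R]_b) :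
  sqint X -> sqint X' -> sqint Y ->
  xmoment (fun w => X w + X' w) Y = xmoment X Y + xmoment X' Y.
Proof.
move=> X2 X'2 Y2; apply/matrixP => i j; rewrite !mxE.
under eq_fun do rewrite mxE mulrDl.
have XY1 := sqint_Lfun1 i j X2 Y2; have X'Y1 := sqint_Lfun1 i j X'2 Y2.
by rewrite [X in fine X]expectationD// fineD// expectation_fin_num.
Qed.

Lemma xmomentMl {a b c} (A : 'M[R]_(c, a)) (X : T -> 'cV[R]_a)
    (Y : T -> 'cV[R]_b) :
  sqint X -> sqint Y -> xmoment (fun w => A *m X w) Y = A *m xmoment X Y.
Proof.
move=> X2 Y2; apply/matrixP => i j; rewrite !mxE.
under eq_fun => w.
  rewrite mxE mulr_suml; under eq_bigr do rewrite -mulrA; over.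
rewrite expectation_suml => [|k]; last exact: sqint_Lfun1.
by apply: eq_bigr => k _; rewrite mxE.
Qed.

(** One step of the covariance recursion: the cross terms vanish. *)
Lemma xmoment_uncor {a b c} (A : 'M[R]_(c, a)) (B : 'M[R]_(c, b))
    (X : T -> 'cV[R]_a) (Y : T -> 'cV[R]_b) :
  sqint X -> sqint Y -> xmoment X Y = 0 ->
  xmoment (fun w => A *m X w + B *m Y w) (fun w => A *m X w + B *m Y w)
    = A *m xmoment X X *m A^T + B *m xmoment Y Y *m B^T.
Proof.
move=> X2 Y2 XY0; have YX0 : xmoment Y X = 0 by rewrite -trmx_xmoment XY0 trmx0.
have AX2 := sqintM A X2; have BY2 := sqintM B Y2.
have AB2 := sqintD AX2 BY2.
rewrite xmomentDl// !xmomentMl//.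
(* Linearity in the second argument is linearity in the first, after transposition. *)
rewrite -![xmoment _ (fun w => _ + _)]trmx_xmoment !xmomentDl// !xmomentMl//.
by rewrite YX0 XY0 !mulmx0 addr0 add0r !trmx_mul !trmx_xmoment !mulmxA.
Qed.

Lemma expectation_mx_sqr {a} (X : T -> 'cV[R]_a) : sqint X ->
  expectation_mx P (fun w => X w *m (X w)^T) = map_mx EFin (xmoment X X).
Proof.
move=> X2; apply/matrixP => i j; rewrite !mxE.
under eq_fun do rewrite mxE big_ord1 mxE.
by rewrite fineK// expectation_fin_num// sqint_Lfun1.
Qed.

Lemma sqint_expectation {a} (X : T -> 'cV[R]_a) (Q : 'M[R]_a) :
  random_vector X ->
  expectation_mx P (fun w => X w *m (X w)^T) = map_mx EFin Q -> sqint X.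
Proof.
move=> mX EX i; apply: Lfun2_expectation_sqr => //.
have := congr1 (fun M : 'M[\bar R]_a => M i i) EX; rewrite /expectation_mx !mxE.
by under eq_fun do rewrite mxE big_ord1 mxE; move=> ->.
Qed.

Lemma xmoment_expectation {a} (X : T -> 'cV[R]_a) (Q : 'M[R]_a) :
  expectation_mx P (fun w => X w *m (X w)^T) = map_mx EFin Q ->
  xmoment X X = Q.
Proof.
move=> EX; apply/matrixP => i j.
have := congr1 (fun M : 'M[\bar R]_a => M i j) EX; rewrite !mxE.
by under eq_fun do rewrite mxE big_ord1 mxE; move=> ->.
Qed.

(** For a centred vector the diagonal covariances are the expectations of the squared entries. *)
Lemma sqint_covariance {a} (X : T -> 'cV[R]_a) (Q : 'M[R]_a) :
  random_vector X -> expectation_mx P X = map_mx EFin 0 ->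
  covariance_mx P X = map_mx EFin Q -> sqint X.
Proof.
move=> mX EX covX i; apply: Lfun2_expectation_sqr => //.
have Ei : expectation P (fun w => X w i 0) = 0%E.
  by have /matrixP/(_ i 0) := EX; rewrite !mxE.
have /matrixP/(_ i i) := covX; rewrite !mxE unlock Ei /=.
have -> : ((fun w => X w i 0) \- cst 0) = (fun w => X w i 0).
  by apply/funext => w; rewrite /= subr0.
rewrite [Z in expectation _ Z = _](_ : _ = fun w => X w i 0 * X w i 0)//.
by move=> ->.
Qed.

Lemma sigma_vector_preimage {a} (X : T -> 'cV[R]_a) i (B : set R) :
  measurable B -> sigma_vector X ((fun w => X w i 0) @^-1` B).
Proof.
move=> mB; apply: sub_sigma_algebra; rewrite (bigD1 i)//=.
by left; exists B => //; rewrite setTI.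
Qed.

(** Entrywise, the expectation of the product factors and the factor from [X] is zero. *)
Lemma xmoment_indep {a b} (X : T -> 'cV[R]_a) (Y : T -> 'cV[R]_b) :
  random_vector X -> random_vector Y ->
  (forall A B, sigma_vector X A -> sigma_vector Y B ->
    P (A `&` B) = P A * P B)%E ->
  expectation_mx P X = map_mx EFin 0 -> sqint X -> sqint Y ->
  xmoment X Y = 0.
Proof.
move=> mX mY indep EX X2 Y2; apply/matrixP => i j; rewrite !mxE.
have Lsub Z : Z \in Lfun P 2%:E -> Z \in Lfun P 1.
  exact: (Lfun_subset12 (fin_num_measure P _ measurableT)).
rewrite [X in fine X]expectationM_indep => //; last 4 first.
- by move=> A B mA mB; apply: indep; exact: sigma_vector_preimage.
- exact: Lsub.
- exact: Lsub.
- exact: sqint_Lfun1.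
have := congr1 (fun M : 'cV[\bar R]_a => M i 0) EX; rewrite !mxE => ->.
by rewrite mul0e.
Qed.

Lemma sqint_stackv {N a} (X : T -> 'I_N -> 'cV[R]_a) :
  (forall k, sqint (fun w => X w k)) -> sqint (fun w => stackv (X w)).
Proof.
move=> X2 r; under eq_fun do rewrite mxE; exact: X2.
Qed.

Lemma xmoment_stackv {N N' a b} (X : T -> 'I_N -> 'cV[R]_a)
    (Y : T -> 'I_N' -> 'cV[R]_b) r s :
  xmoment (fun w => stackv (X w)) (fun w => stackv (Y w)) r s =
  xmoment (fun w => X w (mxtens_unindex r).1)
          (fun w => Y w (mxtens_unindex s).1)
          (mxtens_unindex r).2 (mxtens_unindex s).2.
Proof. by rewrite !mxE; under eq_fun do rewrite !mxE. Qed.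

Lemma xmoment_stackv0 {K a b} (X : T -> 'I_K -> 'cV[R]_a)
    (Y : T -> 'cV[R]_b) :
  (forall k, xmoment (fun w => X w k) Y = 0) ->
  xmoment (fun w => stackv (X w)) Y = 0.
Proof.
move=> XY0; apply/matrixP => r j; rewrite !mxE.
have /matrixP/(_ (mxtens_unindex r).2 j) := XY0 (mxtens_unindex r).1.
by rewrite !mxE => <-; under eq_fun do rewrite mxE.
Qed.

(** All nodes see the same process noise, so all blocks coincide; this is the origin of the factor 1
    1^T in the theorem. *)
Lemma xmoment_stackv_const {N a} (X : T -> 'cV[R]_a) :
  xmoment (fun w => stackv (fun _ : 'I_N => X w)) (fun w => stackv (fun=> X w))
    = ((const_mx 1 : 'cV[R]_N) *m (const_mx 1 : 'cV[R]_N)^T) *t xmoment X X.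
Proof.
by apply/matrixP => r s; rewrite xmoment_stackv !mxE big_ord1 !mxE mulr1 mul1r.
Qed.

End SecondMoments.

(** * Positive definite and semidefinite matrices *)

Section PositiveMatrices.
Context {R : realType}.

Lemma psdmx_congr {m n} (A : 'M[R]_(m, n)) (S : 'M[R]_n) :
  psdmx S -> psdmx (A *m S *m A^T).
Proof.
move=> [St S0]; split; first by rewrite !trmx_mul trmxK St mulmxA.
by move=> u; have := S0 (A^T *m u); rewrite trmx_mul trmxK !mulmxA.
Qed.

Lemma psdmxD {n} (S S' : 'M[R]_n) : psdmx S -> psdmx S' -> psdmx (S + S').
Proof.
move=> [St S0] [S't S'0]; split; first by rewrite linearD /= St S't.
by move=> u; rewrite mulmxDr mulmxDl mxE addr_ge0.
Qed.

Lemma psdmx_sum {n} (I : finType) (A : {pred I}) (S : I -> 'M[R]_n) :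
  (forall k, psdmx (S k)) -> psdmx (\sum_(k in A) S k).
Proof.
move=> S0; elim/big_rec: _ => [|k S' _]; last exact: psdmxD.
by split=> [|u]; rewrite ?trmx0// mulmx0 mul0mx mxE.
Qed.

Lemma pdmx_psdmx {n} (S : 'M[R]_n) : pdmx S -> psdmx S.
Proof.
move=> [St S0]; split=> // u; have [->|/S0/ltW//] := eqVneq u 0.
by rewrite mulmx0 mxE.
Qed.

Lemma pdmxDr {n} (S S' : 'M[R]_n) : pdmx S -> psdmx S' -> pdmx (S + S').
Proof.
move=> [St S0] [S't S'0]; split; first by rewrite linearD /= St S't.
by move=> u u0; rewrite mulmxDr mulmxDl mxE ltr_pwDl// S0.
Qed.

(** A nonzero row in the left kernel would make the quadratic form vanish at its transpose. *)
Lemma pdmx_unit {n} (S : 'M[R]_n) : pdmx S -> S \in unitmx.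
Proof.
move=> [St S0]; rewrite -row_free_unit -kermx_eq0; apply/negPn/negP.
case/rowV0Pn => u /sub_kermxP uS u0.
have /S0 : u^T != 0 by rewrite -(inj_eq trmx_inj) trmxK trmx0.
by rewrite trmxK uS mul0mx mxE ltxx.
Qed.

Lemma sqr_cV_eq0 {n} (v : 'cV[R]_n) : (v^T *m v) 0 0 = 0 -> v = 0.
Proof.
rewrite mxE => v0; apply/colP => a; rewrite mxE; apply/eqP.
rewrite -sqrf_eq0; apply/eqP; move: a (isT).
suff /psumr_eq0P : \sum_a v a 0 ^+ 2 = 0 by apply=> // a _; exact: sqr_ge0.
by rewrite -[RHS]v0; apply: eq_bigr => a _; rewrite mxE expr2.
Qed.

(* If [u^T S u = 0], then [t |-> (u + t S u)^T S (u + t S u)] is nonnegative,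
   vanishes at [0] and has derivative [2 |S u|^2] there, so [S u = 0]. *)
Lemma psdmx_unit_pdmx {n} (S : 'M[R]_n) :
  psdmx S -> S \in unitmx -> pdmx S.
Proof.
move=> [St S0] Su; split=> // u u0; rewrite lt_neqAle S0 andbT eq_sym.
apply: contra_neq u0 => uSu.
suff : S *m u = 0.
  by move=> /(congr1 (mulmx (invmx S))); rewrite mulKmx// mulmx0.
apply: sqr_cV_eq0; set v := S *m u; set a := (v^T *m v) 0 0.
set b := (v^T *m S *m v) 0 0.
have b0 : 0 <= b := S0 v.
have a1 : (u^T *m S *m v) 0 0 = a by rewrite /a /v trmx_mul St.
have a2 : (v^T *m S *m u) 0 0 = a by rewrite /a /v !mulmxA.
have ineq t : 0 <= t * a *+ 2 + t ^+ 2 * b.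
  have := S0 (u + t *: v).
  have -> : (u + t *: v)^T = u^T + t *: v^T by rewrite linearD linearZ.
  rewrite !mulmxDl !mulmxDr -!scalemxAr -!scalemxAl -?scalemxAr.
  have entryD (A B : 'M[R]_1) : (A + B) 0 0 = A 0 0 + B 0 0 by rewrite mxE.
  have entryZ c (A : 'M[R]_1) : (c *: A) 0 0 = c * A 0 0 by rewrite mxE.
  rewrite !(entryD, entryZ).
  rewrite uSu a1 a2 -/b.
  by rewrite add0r addrA mulr2n mulrA -expr2.
(* The minimiser -a/b is replaced by -a/(b+1) to avoid dividing by zero. Multiplied by (b+1)^2, the
   inequality becomes 0 <= -a^2 (b+2). *)
have := ineq (- (a / (b + 1))).
have b1 : 0 < b + 1 by rewrite ltr_wpDl.
rewrite sqrrN exprMn exprVn => h.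
have : 0 <= - (a ^+ 2 * (b + 2)).
  suff -> : - (a ^+ 2 * (b + 2)) =
     (b + 1) ^+ 2 * (- (a / (b + 1)) * a *+ 2 + a ^+ 2 / (b + 1) ^+ 2 * b).
    by rewrite mulr_ge0// sqr_ge0.
  by field; rewrite gt_eqF.
rewrite oppr_ge0 pmulr_lle0; last by rewrite ltr_wpDl.
by move=> a0; apply/eqP; rewrite -sqrf_eq0 eq_le a0 sqr_ge0.
Qed.

(** The form of [invmx S] at [u] is that of [S] at [invmx S *m u]; semidefiniteness and
    invertibility then give definiteness. *)
Lemma pdmx_inv {n} (S : 'M[R]_n) : pdmx S -> pdmx (invmx S).
Proof.
move=> pS; have Su := pdmx_unit pS; have [St S0] := pdmx_psdmx pS.
apply: psdmx_unit_pdmx; last by rewrite unitmx_inv.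
have St' : (invmx S)^T = invmx S by rewrite trmx_inv St.
split=> // u; have := S0 (invmx S *m u).
by rewrite trmx_mul St' -!mulmxA mulKVmx// mulmxA.
Qed.

End PositiveMatrices.

(** * Action of block-diagonal and Kronecker matrices on stacked vectors *)

Section BlockMatrices.
Context {R : realType}.

Lemma sum_mxtens {N n} (f : 'I_N -> 'I_n -> R) :
  \sum_(r < N * n) f (mxtens_unindex r).1 (mxtens_unindex r).2
    = \sum_k \sum_a f k a.
Proof.
rewrite pair_bigA /= (reindex (@mxtens_unindex N n)) //=.
exists (fun ka => mxtens_index ka) => x _;
  by rewrite (mxtens_indexK, mxtens_unindexK).
Qed.

Lemma eq_stackv {N m} (x y : 'I_N -> 'cV[R]_m) : x =1 y -> stackv x = stackv y.
Proof. by move=> xy; congr stackv; exact/funext. Qed.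

Lemma stackvD {N m} (x y : 'I_N -> 'cV[R]_m) :
  stackv x + stackv y = stackv (fun k => x k + y k).
Proof. by apply/colP => r; rewrite !mxE. Qed.

Lemma stackvN {N m} (x : 'I_N -> 'cV[R]_m) :
  - stackv x = stackv (fun k => - x k).
Proof. by apply/colP => r; rewrite !mxE. Qed.

Lemma mul_blockdiag_stackv {N m n} (B : 'I_N -> 'M[R]_(m, n))
    (x : 'I_N -> 'cV[R]_n) :
  blockdiag B *m stackv x = stackv (fun k => B k *m x k).
Proof.
apply/colP => r; rewrite !mxE; under eq_bigr do rewrite !mxE.
case: (mxtens_unindex r) => k a /=.
rewrite [LHS](sum_mxtens
  (fun l b => (if k == l then B k a b else 0) * x l b 0)).
rewrite (bigD1 k)//= [X in _ + X]big1 ?addr0 => [|l lk].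
  by apply: eq_bigr => b _; rewrite eqxx.
by apply: big1 => b _; rewrite eq_sym (negPf lk) mul0r.
Qed.

Lemma mul_tens1_stackv {N m} (C : 'M[R]_N) (x : 'I_N -> 'cV[R]_m) :
  (C *t (1%:M : 'M[R]_m)) *m stackv x
    = stackv (fun k => \sum_j C k j *: x j).
Proof.
apply/colP => r; rewrite !mxE; under eq_bigr do rewrite !mxE.
case: (mxtens_unindex r) => k a.
rewrite [LHS](sum_mxtens (fun l b => C k l * (a == b)%:R * x l b 0)) summxE.
apply: eq_bigr => l _; rewrite !mxE (bigD1 a)//= big1 ?addr0 => [|b ba].
  by rewrite eqxx mulr1.
by rewrite eq_sym (negPf ba) mulr0 mul0r.
Qed.

Lemma blockdiag_const {N m n} (A : 'M[R]_(m, n)) :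
  (1%:M : 'M[R]_N) *t A = blockdiag (fun=> A).
Proof.
by apply/matrixP => r s; rewrite !mxE; case: ifP => _; rewrite ?mul1r ?mul0r.
Qed.

Lemma trmx_blockdiag {N m n} (B : 'I_N -> 'M[R]_(m, n)) :
  (blockdiag B)^T = blockdiag (fun k => (B k)^T).
Proof.
by apply/matrixP => r s; rewrite !mxE eq_sym; case: eqP => // ->.
Qed.

Lemma col_stackv {N m} (u : 'cV[R]_(N * m)) :
  u = stackv (fun k => \col_a u (mxtens_index (k, a)) 0).
Proof.
apply/colP => r; rewrite !mxE; congr (u _ _).
by rewrite -[LHS]mxtens_unindexK.
Qed.

Lemma invmx_blockdiag {N m} (B : 'I_N -> 'M[R]_m) :
  (forall k, B k \in unitmx) ->
  invmx (blockdiag B) = blockdiag (fun k => invmx (B k)).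
Proof.
move=> Bu; have BB1 : blockdiag B *m blockdiag (fun k => invmx (B k)) = 1%:M.
  (* Column [s] is the value at [delta_mx s 0], which is itself a stack, so both factors act on it
     blockwise. *)
  apply/matrixP => r s.
  have /colP/(_ r) : blockdiag B *m blockdiag (fun k => invmx (B k))
      *m delta_mx s 0 = 1%:M *m delta_mx s (0 : 'I_1).
    rewrite -mulmxA mul1mx [delta_mx _ _]col_stackv !mul_blockdiag_stackv.
    by apply: eq_stackv => k; rewrite mulKVmx.
  by rewrite -!colE !mxE.
have [Bdu _] := mulmx1_unit BB1.
by rewrite -[RHS]mul1mx -(mulVmx Bdu) -mulmxA BB1 mulmx1.
Qed.

End BlockMatrices.

(** * Definiteness of the filter matrices and pathwise error recursions *)

Section FilterErrors.
Context {R : realType} {N m p d q : nat} (S : dkf R N m p d q).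

(** Congruence by a possibly singular [F] preserves only semidefiniteness, so each step of the
    induction regains definiteness from the assumed invertibility. *)
Lemma Ppred_pdmx :
  pdmx (dkf_Pi0 S) -> (forall i, psdmx (dkf_Q S i)) ->
  (forall i, pdmx (dkf_R S i)) -> (forall i k, Ppred S i k \in unitmx) ->
  forall i k, pdmx (Ppred S i k).
Proof.
move=> Pi0 Q0 R0 Pu; elim=> [//|i IH] k.
apply: psdmx_unit_pdmx; last exact: Pu.
apply: psdmxD; apply: psdmx_congr => //.
apply: pdmx_psdmx; rewrite /cov_update; case: ifP => // _.
apply: pdmx_inv; apply: pdmxDr; first exact: pdmx_inv.
apply: psdmx_sum => j; rewrite -[X in _ *m X]trmxK; apply: psdmx_congr.
exact/pdmx_psdmx/pdmx_inv.
Qed.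

Context {T : Type} (x0 : T -> 'cV[R]_m) (n : nat -> T -> 'cV[R]_p)
  (v : 'I_N -> nat -> T -> 'cV[R]_d).

Definition pred_error (s : nat) (w : T) : 'cV[R]_(N * m) :=
  stackv (fun k => state S x0 n s w - xpred S x0 n v s w k).

Lemma pred_error0 w : pred_error 0 w = stackv (fun=> x0 w).
Proof. by apply: eq_stackv => k; rewrite subr0. Qed.

Lemma pred_errorS s w : pred_error s.+1 w =
  ((1%:M : 'M[R]_N) *t dkf_F S s) *m aug_error S x0 n v s w
  + ((1%:M : 'M[R]_N) *t dkf_G S s) *m stackv (fun=> n s w).
Proof.
rewrite !blockdiag_const /aug_error !mul_blockdiag_stackv stackvD.
by apply: eq_stackv => k /=; rewrite mulmxBr addrAC.
Qed.

Lemma aug_error_untriggered s w :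
  ~~ trigger S s -> aug_error S x0 n v s w = pred_error s w.
Proof.
by move=> /negPf ns; apply: eq_stackv => k; rewrite /xfilt /est_update ns.
Qed.

(** The matrix Z of the theorem, at a general time [s] in place of i+M+1. *)
Definition error_gain s : 'M[R]_(N * m) :=
  (dkf_C S *t (1%:M : 'M[R]_m))^T *m blockdiag (Pfilt S s)
    *m invmx (blockdiag (Ppred S s)).

(** The matrix E of the theorem, at a general time [s]. *)
Definition noise_gain s : 'M[R]_(N * m, N * d) :=
  (dkf_C S *t (1%:M : 'M[R]_m))^T *m blockdiag (Pfilt S s)
    *m (adjacency S *t (1%:M : 'M[R]_m))^T
    *m (blockdiag (fun k => dkf_H S k s))^T
    *m invmx ((1%:M : 'M[R]_N) *t dkf_R S s).

(* [I - P_{k,s|s} sum_l H_l^T R^-1 H_l = P_{k,s|s} P_{k,s|s-1}^-1] by the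
   definition of [P_{k,s|s}]. *)
Lemma Psi_error s w k :
  trigger S s -> (forall i k, pdmx (Ppred S i k)) ->
  (forall i, pdmx (dkf_R S i)) ->
  state S x0 n s w
    - Psi S s (xpred S x0 n v s w) (meas S x0 n v s w) k =
  Pfilt S s k *m (invmx (Ppred S s k)
                    *m (state S x0 n s w - xpred S x0 n v s w k))
  - Pfilt S s k *m \sum_(l in dkf_nbr S k)
        (dkf_H S l s)^T *m (invmx (dkf_R S s) *m v l s w).
Proof.
move=> trig Ppd R0; rewrite /Psi /meas.
set x := state _ _ _ _ _; set xp := xpred _ _ _ _ _ _ k.
pose Sg := \sum_(j in dkf_nbr S k)
  (dkf_H S j s)^T *m invmx (dkf_R S s) *m dkf_H S j s.
have PE : Pfilt S s k = invmx (invmx (Ppred S s k) + Sg).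
  by rewrite /Pfilt /cov_update; move: trig; rewrite /trigger => ->.
have Pu : invmx (Ppred S s k) + Sg \in unitmx.
  apply/pdmx_unit/pdmxDr; first exact/pdmx_inv.
  apply: psdmx_sum => j; rewrite -[X in _ *m X]trmxK; apply: psdmx_congr.
  exact/pdmx_psdmx/pdmx_inv.
(* Each innovation is [H] applied to the prediction error, plus the measurement noise. *)
have -> : \sum_(j in dkf_nbr S k) (dkf_H S j s)^T *m invmx (dkf_R S s)
      *m (dkf_H S j s *m x + v j s w - dkf_H S j s *m xp) =
    Sg *m (x - xp) + \sum_(l in dkf_nbr S k)
        (dkf_H S l s)^T *m (invmx (dkf_R S s) *m v l s w).
  rewrite mulmx_suml -big_split; apply: eq_bigr => j _.
  by rewrite addrAC -mulmxBr mulmxDr !mulmxA.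
(* Adding and subtracting the [Sg] term lets [Pfilt] cancel against its own inverse. *)
have -> : invmx (Ppred S s k) *m (x - xp) =
    (invmx (Ppred S s k) + Sg) *m (x - xp) - Sg *m (x - xp).
  by rewrite mulmxDl addrK.
have PK : Pfilt S s k *m ((invmx (Ppred S s k) + Sg) *m (x - xp)) = x - xp.
  by rewrite PE mulKmx.
rewrite [_ *m (_ - Sg *m _)]mulmxBr PK mulmxDr.
by rewrite !opprD !addrA.
Qed.

Lemma aug_error_triggered s w :
  trigger S s -> (forall i k, pdmx (Ppred S i k)) ->
  (forall i, pdmx (dkf_R S i)) ->
  (forall j k, j \notin dkf_nbr S k -> dkf_C S j k = 0) ->
  (forall k, \sum_(j in dkf_nbr S k) dkf_C S j k = 1) ->
  aug_error S x0 n v s w =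
  error_gain s *m pred_error s w
  + (- noise_gain s) *m stackv (fun k => v k s w).
Proof.
move=> trig Ppd R0 c0 c1.
rewrite /error_gain /noise_gain mulNmx -!mulmxA !trmx_tens trmx1.
rewrite invmx_blockdiag => [|k]; last exact/pdmx_unit.
rewrite blockdiag_const invmx_blockdiag => [|k]; last exact/pdmx_unit.
rewrite trmx_blockdiag !mul_blockdiag_stackv !mul_tens1_stackv.
rewrite !mul_blockdiag_stackv !mul_tens1_stackv stackvN stackvD.
apply: eq_stackv => k; rewrite /xfilt /est_update trig.
(* Since the weights sum to 1, the state is its own weighted combination, and the diffused error is
   the combination of the errors of the [Psi]. *)
rewrite -[X in X - _ = _]scale1r -(c1 k) scaler_suml -!sumrB.
rewrite big_mkcond; apply: eq_bigr => j _; rewrite mxE; case: ifPn => [jk|].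
  rewrite -!scalerBr Psi_error//. congr (_ *: (_ - _ *m _)).
  (* The 0-1 entries of the transposed adjacency matrix select the neighbors of node [j]. *)
  rewrite big_mkcond; apply: eq_bigr => l _; rewrite !mxE.
  by case: ifP; rewrite (scale1r, scale0r).
by move=> /c0 ->; rewrite !scale0r subr0.
Qed.

End FilterErrors.

(** * Independence of pairs, unrolling of the recursion, and stacked uncorrelated noises *)

Lemma mutually_independent_pair {disp : measure_display}
    {T : measurableType disp} {R : realType} (P : probability T R) (I : eqType)
    (G : I -> set_system T) (a b : I) (A B : set T) :
  mutually_independent P G -> a != b -> G a A -> G b B ->
  P (A `&` B) = (P A * P B)%E.
Proof.
move=> indep ab GA GB.
(* Mutual independence is applied to the list [[:: a; b]], so only the values of [C] at [a] and [b]
   matter. *)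
pose C c := if c == a then A else B.
have Ca : C a = A by rewrite /C eqxx.
have Cb : C b = B by rewrite /C eq_sym (negPf ab).
have := indep [:: a; b] C; rewrite !big_cons big_nil mule1 Ca Cb /= inE ab.
move=> <- //; last first.
  by move=> c; rewrite !inE => /orP[]/eqP ->; rewrite ?Ca ?Cb.
congr (P _); apply/seteqP; split=> [w [Aw Bw] c|w ABw].
  by rewrite /= !inE => /orP[]/eqP ->; rewrite ?Ca ?Cb.
by split; [rewrite -Ca|rewrite -Cb]; apply: ABw; rewrite /= !inE eqxx ?orbT.
Qed.

(** Here [U] stands for prediction and [V] for filtered covariances, equal between triggers. [Gam l]
    carries the noise of time i+l-1 to time i+M+1; the last noise, of time i+M, stays outside the
    sum. *)
Lemma unroll_covariance {R : realType} {a b : nat} (F : nat -> 'M[R]_a)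
    (G : nat -> 'M[R]_(a, b)) (W : nat -> 'M[R]_b) (U V : nat -> 'M[R]_a)
    (i M : nat) :
  (forall s, U s.+1 = F s *m V s *m (F s)^T + G s *m W s *m (G s)^T) ->
  (forall s, (i < s <= i + M)%N -> V s = U s) ->
  let Phi := \prod_(0 <= j < M.+1) F (i + M - j)%N in
  let Gam l := \prod_(0 <= j < (M - l).+1) F (i + M - j)%N *m G (i + l - 1)%N in
  U (i + M).+1 = Phi *m V i *m Phi^T
    + G (i + M)%N *m W (i + M)%N *m (G (i + M)%N)^T
    + \sum_(1 <= l < M.+1) Gam l *m W (i + l - 1)%N *m (Gam l)^T.
Proof.
move=> US; elim: M => [|M IH] VU /=.
  by rewrite addn0 big_nat1 subn0 US big_geq// addr0.
have VM : V (i + M.+1)%N = U (i + M).+1.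
  by rewrite VU addnS// ltnS leq_addr leqnn.
rewrite US VM IH => [|s /andP[is_ sM]]; last first.
  by rewrite VU// is_ addnS leqW.
have prodS r : \prod_(0 <= j < r.+1) F ((i + M).+1 - j)%N =
    F (i + M).+1 *m \prod_(0 <= j < r) F (i + M - j)%N.
  by rewrite big_nat_recl// subn0.
(* The isolated noise term of the previous step, now multiplied by one [F], becomes the new summand
   l = M+1. *)
rewrite addnS prodS [\sum_(1 <= l < M.+2) _]big_nat_recr//= subnn big_nat1.
rewrite subn0 addnS subn1 /= !mulmxDr !mulmxDl !trmx_mul !mulmxA.
rewrite -!addrA; congr (_ + _).
rewrite addrCA [RHS]addrCA [X in _ = _ + X]addrC; congr (_ + _).
rewrite mulmx_sumr mulmx_suml; apply: eq_big_nat => l /andP[_ lM].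
rewrite subSn// prodS.
by rewrite !trmx_mul !mulmxA.
Qed.

(** Unlike the shared process noise, the measurement noises differ from node to node, so only
    diagonal blocks survive. *)
Lemma xmoment_stackv_uncor {disp : measure_display} {T : measurableType disp}
    {R : realType} (P : probability T R) {N a} (X : 'I_N -> T -> 'cV[R]_a)
    (Q : 'M[R]_a) :
  (forall k, xmoment P (X k) (X k) = Q) ->
  (forall k l, k != l -> xmoment P (X k) (X l) = 0) ->
  xmoment P (fun w => stackv (X^~ w)) (fun w => stackv (X^~ w))
    = (1%:M : 'M[R]_N) *t Q.
Proof.
move=> XQ X0; apply/matrixP => r s.
rewrite xmoment_stackv blockdiag_const [RHS]mxE.
case: (mxtens_unindex r) (mxtens_unindex s) => k i [l j] /=.
have [->|/X0/matrixP/(_ i j)] := eqVneq k l; last first.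
  by move=> XX; rewrite [LHS]XX mxE.
by have /matrixP/(_ i j) := XQ l.
Qed.

(** * Correlation between the filter errors and a test vector *)

Section FilterMoments.
Context {disp : measure_display} {T : measurableType disp} {R : realType}.
Variable P : probability T R.
Context {N m p d q : nat} (S : dkf R N m p d q).
Context (x0 : T -> 'cV[R]_m) (n : nat -> T -> 'cV[R]_p)
  (v : 'I_N -> nat -> T -> 'cV[R]_d).

Hypotheses (x0_sq : sqint P x0) (n_sq : forall i, sqint P (n i))
  (v_sq : forall k i, sqint P (v k i)).
Hypotheses (Ppd : forall i k, pdmx (Ppred S i k))
  (R_pd : forall i, pdmx (dkf_R S i))
  (c_nbr : forall j k, j \notin dkf_nbr S k -> dkf_C S j k = 0)
  (c_sum : forall k, \sum_(j in dkf_nbr S k) dkf_C S j k = 1).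

(** Errors are linear in the sources, so orthogonality to [Y] passes from sources to errors by
    induction on time. The two conclusions are separated because [v k s] enters the filtered error
    at [s] but not the prediction error. *)
Lemma errors_uncorrelated {b} (Y : T -> 'cV[R]_b) s :
  sqint P Y -> xmoment P x0 Y = 0 ->
  (forall t, (t < s)%N -> xmoment P (n t) Y = 0) ->
  (forall k t, (t < s)%N -> xmoment P (v k t) Y = 0) ->
  (sqint P (pred_error S x0 n v s) /\ xmoment P (pred_error S x0 n v s) Y = 0)
  /\ ((forall k, xmoment P (v k s) Y = 0) ->
      sqint P (aug_error S x0 n v s) /\ xmoment P (aug_error S x0 n v s) Y = 0).
Proof.
move=> Y2 xY.
have lin a c (A : 'M[R]_(N * m, a)) (B : 'M[R]_(N * m, c))
    (X : T -> 'cV[R]_a) X' :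
    sqint P X /\ xmoment P X Y = 0 -> sqint P X' /\ xmoment P X' Y = 0 ->
    sqint P (fun w => A *m X w + B *m X' w) /\
    xmoment P (fun w => A *m X w + B *m X' w) Y = 0.
  move=> [X2 XY] [X'2 X'Y]; split; first by apply: sqintD; exact: sqintM.
  by rewrite xmomentDl ?xmomentMl ?XY ?X'Y ?mulmx0 ?addr0//; exact: sqintM.
have filt t :
  sqint P (pred_error S x0 n v t) /\ xmoment P (pred_error S x0 n v t) Y = 0 ->
  (forall k, xmoment P (v k t) Y = 0) ->
  sqint P (aug_error S x0 n v t) /\ xmoment P (aug_error S x0 n v t) Y = 0.
  move=> et vt; case/boolP: (trigger S t) => trig; last first.
    by have -> : aug_error S x0 n v t = pred_error S x0 n v t
      by apply/funext => w; exact: aug_error_untriggered.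
  have -> : aug_error S x0 n v t = fun w =>
      error_gain S t *m pred_error S x0 n v t w
      + (- noise_gain S t) *m stackv (fun k => v k t w).
    by apply/funext => w; exact: aug_error_triggered.
  by apply: lin => //; split; [exact: sqint_stackv|exact: xmoment_stackv0].
elim: s => [|s IH] nY vY.
  suff e0 : sqint P (pred_error S x0 n v 0) /\
      xmoment P (pred_error S x0 n v 0) Y = 0 by split=> //; exact: filt.
  have -> : pred_error S x0 n v 0 = fun w => stackv (fun=> x0 w).
    by apply/funext => w; exact: pred_error0.
  by split; [exact: sqint_stackv|exact: xmoment_stackv0].
suff eS : sqint P (pred_error S x0 n v s.+1) /\
    xmoment P (pred_error S x0 n v s.+1) Y = 0 by split=> //; exact: filt.
have -> : pred_error S x0 n v s.+1 = fun w =>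
    ((1%:M : 'M[R]_N) *t dkf_F S s) *m aug_error S x0 n v s w
    + ((1%:M : 'M[R]_N) *t dkf_G S s) *m stackv (fun=> n s w).
  by apply/funext => w; exact: pred_errorS.
apply: lin.
  have [_] := IH (fun t ts => nY t (ltnW ts)) (fun k t ts => vY k t (ltnW ts)).
  by apply=> k; exact: vY.
by split; [exact: sqint_stackv|apply: xmoment_stackv0 => k; exact: nY].
Qed.

Lemma sqint_errors s :
  sqint P (pred_error S x0 n v s) /\ sqint P (aug_error S x0 n v s).
Proof.
(* With [Y] of dimension 0 all moment conditions are trivial and only square-integrability
   remains. *)
have [||||[e2 _] [//|a2 _]] := @errors_uncorrelated 0 (fun=> 0) s;
  do ?by move=> *; rewrite !thinmx0.
  by case.
by split.
Qed.

End FilterMoments.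

(** * Covariance relation between consecutive triggering times *)

Theorem lemma2 (R : realType) (N m p d q : nat) (S : dkf R N m p d q)
    (disp : measure_display) (T : measurableType disp) (P : probability T R)
    (x0 : T -> 'cV[R]_m) (n : nat -> T -> 'cV[R]_p)
    (v : 'I_N -> nat -> T -> 'cV[R]_d)
    (x0_meas : random_vector x0)
    (n_meas : forall i, random_vector (n i))
    (v_meas : forall k i, random_vector (v k i))
    (indep : mutually_independent P (source_sigma x0 n v))
    (Pi0_pd : pdmx (dkf_Pi0 S))
    (x0_mean : expectation_mx P x0 = map_mx EFin 0)
    (x0_cov : covariance_mx P x0 = map_mx EFin (dkf_Pi0 S))
    (Q_psd : forall i, psdmx (dkf_Q S i))
    (n_gauss : forall i, gaussian_vector P (n i))
    (n_mean : forall i, expectation_mx P (n i) = map_mx EFin 0)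
    (n_cov : forall i, expectation_mx P (fun w => n i w *m (n i w)^T)
                       = map_mx EFin (dkf_Q S i))
    (R_pd : forall i, pdmx (dkf_R S i))
    (v_gauss : forall k i, gaussian_vector P (v k i))
    (v_mean : forall k i, expectation_mx P (v k i) = map_mx EFin 0)
    (v_cov : forall k i, expectation_mx P (fun w => v k i w *m (v k i w)^T)
                         = map_mx EFin (dkf_R S i))
    (c_ge0 : forall j k, 0 <= dkf_C S j k)
    (c_nbr : forall j k, j \notin dkf_nbr S k -> dkf_C S j k = 0)
    (c_sum : forall k, \sum_(j in dkf_nbr S k) dkf_C S j k = 1)
    (P_inv : forall i k, Ppred S i k \in unitmx)
    (i M : nat)
    (trig_i : trigger S i)
    (trig_next : trigger S (i + M + 1))
    (no_trig : forall s, (i < s <= i + M)%N -> ~~ trigger S s) :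
  let ones : 'cV[R]_N := const_mx 1 in
  let calC := dkf_C S *t (1%:M : 'M[R]_m) in
  let calA := adjacency S *t (1%:M : 'M[R]_m) in
  let calH := blockdiag (fun k => dkf_H S k (i + M + 1)) in
  let calR := (1%:M : 'M[R]_N) *t dkf_R S (i + M + 1) in
  let calP := blockdiag (Pfilt S (i + M + 1)) in
  let calPp := blockdiag (Ppred S (i + M + 1)) in
  let Z := calC^T *m calP *m invmx calPp in
  let A := Z *m ((1%:M : 'M[R]_N) *t
                 \prod_(0 <= j < M.+1) dkf_F S (i + M - j)) in
  let B := Z *m ((1%:M : 'M[R]_N) *t dkf_G S (i + M)) in
  let D l := Z *m ((1%:M : 'M[R]_N) *t
                   \prod_(0 <= j < (M - l).+1) dkf_F S (i + M - j))
               *m ((1%:M : 'M[R]_N) *t dkf_G S (i + l - 1)) in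
  let E := calC^T *m calP *m calA^T *m calH^T *m invmx calR in
  let PX := error_cov P S x0 n v in
  [/\ error_second_moment P S x0 n v i = map_mx EFin (PX i),
      error_second_moment P S x0 n v (i + M + 1)
        = map_mx EFin (PX (i + M + 1)%N)
    & PX (i + M + 1)%N =
        A *m PX i *m A^T
        + B *m ((ones *m ones^T) *t dkf_Q S (i + M)) *m B^T
        + \sum_(1 <= l < M.+1)
            D l *m ((ones *m ones^T) *t dkf_Q S (i + l - 1)) *m (D l)^T
        + E *m calR *m E^T].
Proof.
move=> ones calC calA calH calR calP calPp Z A B D E PX.
have x0_sq := sqint_covariance x0_meas x0_mean x0_cov.
have n_sq t := sqint_expectation (n_meas t) (n_cov t).
have v_sq k t := sqint_expectation (v_meas k t) (v_cov k t).
have Ppd := Ppred_pdmx Pi0_pd Q_psd R_pd P_inv.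
have pair a b U V := @mutually_independent_pair _ _ _ _ _ _ a b U V indep.
have x0n t : xmoment P x0 (n t) = 0.
  apply: xmoment_indep => // U V U0 Vn.
  exact: (pair (inl (inl tt)) (inl (inr t))).
have x0v k t : xmoment P x0 (v k t) = 0.
  apply: xmoment_indep => // U V U0 Vv.
  exact: (pair (inl (inl tt)) (inr (k, t))).
have nn s t : s != t -> xmoment P (n s) (n t) = 0.
  move=> st; apply: xmoment_indep => // U V Un Vn.
  exact: (pair (inl (inr s)) (inl (inr t))).
have nv s k t : xmoment P (n s) (v k t) = 0.
  apply: xmoment_indep => // U V Un Vv.
  exact: (pair (inl (inr s)) (inr (k, t))).
have vv k s l t : (k, s) != (l, t) -> xmoment P (v k s) (v l t) = 0.
  move=> ks; apply: xmoment_indep => // U V Uv Vv.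
  exact: (pair (inr (k, s)) (inr (l, t))).
pose e := pred_error S x0 n v; pose x := aug_error S x0 n v.
have sq s : sqint P (e s) /\ sqint P (x s) by exact: sqint_errors.
have uncor := errors_uncorrelated x0_sq n_sq v_sq Ppd R_pd c_nbr c_sum.
pose nS s w : 'cV[R]_(N * p) := stackv (fun=> n s w).
pose vS s w : 'cV[R]_(N * d) := stackv (fun k => v k s w).
have nS_sq s : sqint P (nS s) by exact: sqint_stackv.
have vS_sq s : sqint P (vS s) by exact: sqint_stackv.
have stackr a K b (X : T -> 'cV[R]_a) (Y : T -> 'I_K -> 'cV[R]_b) :
    (forall k, xmoment P X (fun w => Y w k) = 0) ->
    xmoment P X (fun w => stackv (Y w)) = 0.
  move=> XY; rewrite -trmx_xmoment xmoment_stackv0 ?trmx0// => k.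
  by rewrite -trmx_xmoment XY trmx0.
(* The filtered error at [s] involves [n t] only for t < s. *)
have xn s : xmoment P (x s) (nS s) = 0.
  apply: (proj2 (proj2 (uncor _ _ s (nS_sq s) _ _ _) _)) => [|t ts|k t _|k];
    apply: stackr => // _; rewrite ?nn ?ltn_eqF//.
    by rewrite -trmx_xmoment nv trmx0.
  by rewrite -trmx_xmoment nv trmx0.
(* The prediction error at [s] involves [v k t] only for t < s. *)
have ev s : xmoment P (e s) (vS s) = 0.
  apply: (proj2 (proj1 (uncor _ _ s (vS_sq s) _ _ _))) => [|t _|k t ts];
    apply: stackr => // l; apply: vv.
  by apply/eqP => -[_ st]; rewrite st ltnn in ts.
have secondE s :
    error_second_moment P S x0 n v s = map_mx EFin (xmoment P (x s) (x s)).
  by rewrite -expectation_mx_sqr; case: (sq s).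
have PXE s : PX s = xmoment P (x s) (x s).
  by rewrite /PX /error_cov secondE; apply/matrixP => r j; rewrite !mxE.
split; [by rewrite secondE PXE..|].
rewrite !PXE.
have predS s : xmoment P (e s.+1) (e s.+1) =
    ((1%:M : 'M[R]_N) *t dkf_F S s) *m xmoment P (x s) (x s)
      *m ((1%:M : 'M[R]_N) *t dkf_F S s)^T
    + ((1%:M : 'M[R]_N) *t dkf_G S s) *m ((ones *m ones^T) *t dkf_Q S s)
      *m ((1%:M : 'M[R]_N) *t dkf_G S s)^T.
  rewrite -(xmoment_expectation (n_cov s)) -xmoment_stackv_const.
  rewrite -(xmoment_uncor _ _ (sq s).2 (nS_sq s) (xn s)).
  by congr xmoment; apply/funext => w; exact: pred_errorS.
have untrig s : (i < s <= i + M)%N ->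
    xmoment P (x s) (x s) = xmoment P (e s) (e s).
  move=> /no_trig ns; congr xmoment; apply/funext => w;
    exact: aug_error_untriggered.
have trigE : xmoment P (x (i + M + 1)%N) (x (i + M + 1)%N) =
    Z *m xmoment P (e (i + M + 1)%N) (e (i + M + 1)%N) *m Z^T
    + E *m calR *m E^T.
  (* The measurement noise enters the error with gain [- E]; the sign disappears in the quadratic
     term. *)
  have -> : E *m calR *m E^T = (- E) *m calR *m (- E)^T.
    by rewrite linearN /= mulNmx mulmxN mulNmx opprK.
  rewrite /calR -(xmoment_stackv_uncor (P := P) (X := v^~ (i + M + 1)%N));
    first last.
  - by move=> k l kl; apply: vv; apply: contra kl => /eqP[->].
  - by move=> k; exact: xmoment_expectation.
  rewrite -(xmoment_uncor _ _ (sq _).1 (vS_sq _) (ev _)).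
  by congr xmoment; apply/funext => w; exact: aug_error_triggered.
(* Unrolling produces products of the augmented transition matrices; the mixed-product rule moves
   the product inside the Kronecker factor. *)
have prodE r : \prod_(0 <= j < r.+1) ((1%:M : 'M[R]_N) *t dkf_F S (i + M - j)) =
    (1%:M : 'M[R]_N) *t \prod_(0 <= j < r.+1) dkf_F S (i + M - j).
  elim: r => [|r IH]; first by rewrite !big_nat1.
  rewrite big_nat_recr//= IH [in RHS]big_nat_recr//= -[LHS]/(_ *m _).
  by rewrite tensmx_mul mul1mx.
rewrite trigE addn1 (unroll_covariance predS untrig) /=.
clearbody Z.
rewrite !mulmxDr !mulmxDl mulmx_sumr mulmx_suml prodE.
congr (_ + _ + _ + _).
- by rewrite /A trmx_mul !mulmxA.
- by rewrite /B trmx_mul !mulmxA.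
- apply: eq_big_nat => l _; rewrite prodE /D.
  by rewrite !trmx_mul !mulmxA.
Qed.
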